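(* For every admissible move of the algorithm, applied to a state with real coordinates $(x_1,x_2,x_3)$ and producing real coordinates $(x_1',x_2',x_3')$ (before re-sorting), each real coordinate is non-increasing: $x_i'\le x_i$ for $i=1,2,3$ (same position). In particular $\max_ix_i$ is non-increasing along every orbit.
   Context: $K$ is a cubic number field of signature $(1,1)$ with real embedding $\sigma_r$; $L\subset\mathcal O_K$ is an order. A state is an ordered triple $(u_1,u_2,u_3)$ of elements of $L$ forming a $\mathbb Q$-basis of $K$ with $x_i=\sigma_r(u_i)>0$, sorted so that $x_1\ge x_2\ge x_3>0$. The moves of the algorithm are: $V(A,B,g)$ with $A,B,g\in\mathbb Z_{\ge0}$, sending $(u_1,u_2,u_3)$ to $(u_1-g(u_2-Bu_3)-Au_3,\ u_2-Bu_3,\ u_3)$; and $W$, sending $(u_1,u_2,u_3)$ to $(u_1-u_2,\ u_2,\ u_3-(u_1-u_2))$. A move is admissible at a state (satisfies the window constraints) if all new real coordinates are positive. After a move the triple is re-sorted; an orbit is a sequence of states obtained by successive selected admissible moves. *)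

(* Defs.v *)
(* MathComp world; the real field is an abstract [realType]. *)
From HB Require Import structures.
From mathcomp Require Import all_boot all_order all_algebra all_field.
From mathcomp Require Import complex.
From mathcomp Require Import reals.

Set Implicit Arguments.
Unset Strict Implicit.
Unset Printing Implicit Defensive.

Import Order.TTheory GRing.Theory Num.Theory.
Local Open Scope ring_scope.
Local Open Scope complex_scope.

(* Number fields are finite extensions of [rat].  Morphisms carry structure
   proofs, so embeddings are compared pointwise.  [tau] lists one embedding from each
   complex-conjugate pair of non-real ones. *)
Definition has_signature (R : realType) (K : fieldExtType rat) (r1 r2 : nat)
    : Prop :=
  (exists rho : 'I_r1 -> {rmorphism K -> R},
     (forall i j, rho i =1 rho j -> i = j) /\
     (forall phi : {rmorphism K -> R}, exists i, phi =1 rho i)) /\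
  (exists tau : 'I_r2 -> {rmorphism K -> R[i]},
     [/\ forall i, exists x, tau i x \isn't Num.real,
         forall i j,
           tau i =1 tau j \/ (forall x, tau i x = Num.conj (tau j x)) -> i = j
       & forall phi : {rmorphism K -> R[i]},
           (exists x, phi x \isn't Num.real) ->
           exists i, phi =1 tau i \/ (forall x, phi x = Num.conj (tau i x))]).

Definition in_ring_of_integers (K : fieldExtType rat) (x : K) : Prop :=
  integralOver (intr : int -> K) x.

(* A subring of the ring of integers that is free over Z on a Q-basis of K. *)
Definition is_order (K : fieldExtType rat) (L : {pred K}) : Prop :=
  [/\ subring_closed L,
      forall x, x \in L -> in_ring_of_integers x
    & exists b : (\dim {:K}%VS).-tuple K,
        basis_of {:K}%VS b /\ forall x, x \in L <-> inIntSpan b x].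

Section Algorithm.

Variables (R : realType) (K : fieldExtType rat) (sigma : {rmorphism K -> R}).

Implicit Types t : 3.-tuple K.

(* Positions 1, 2, 3 of a triple are the indices 0, 1, 2 of 'I_3. *)
Definition rcoord t (i : 'I_3) : R := sigma (tnth t i).

Definition is_state (L : {pred K}) t : Prop :=
  [/\ forall i, tnth t i \in L,
      basis_of {:K}%VS t,
      forall i, 0 < rcoord t i
    & forall i j : 'I_3, (i <= j)%N -> rcoord t j <= rcoord t i].

Inductive move : Type :=
  | V of nat & nat & nat
  | W.

Definition apply_move (m : move) t : 3.-tuple K :=
  let u1 := tnth t (inord 0) in
  let u2 := tnth t (inord 1) in
  let u3 := tnth t (inord 2) in
  match m with
  | V A B g => [tuple u1 - (u2 - u3 *+ B) *+ g - u3 *+ A; u2 - u3 *+ B; u3]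
  | W => [tuple u1 - u2; u2; u3 - (u1 - u2)]
  end.

Definition admissible (m : move) t : Prop :=
  forall i, 0 < rcoord (apply_move m t) i.

Definition resort t : 3.-tuple K :=
  [tuple of sort (fun a b => sigma b <= sigma a) t].

Definition max_rcoord t : R :=
  Num.max (rcoord t (inord 0))
    (Num.max (rcoord t (inord 1)) (rcoord t (inord 2))).

(* Orbits may be finite or infinite: the indices of the states of an orbit are
   0, ..., k if N = Some k, and all the natural numbers if N = None. *)
Definition in_orbit_range (N : option nat) (n : nat) : bool :=
  if N is Some k then (n <= k)%N else true.

(* [m n] is the move selected at the state [s n]; the selection rule itself is
   arbitrary. *)
Definition is_orbit (L : {pred K}) (N : option nat) (s : nat -> 3.-tuple K)
    (m : nat -> move) : Prop :=
  (forall n, in_orbit_range N n -> is_state L (s n)) /\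
  (forall n, in_orbit_range N n.+1 ->
     admissible (m n) (s n) /\ s n.+1 = resort (apply_move (m n) (s n))).

End Algorithm.

(* Main.v *)
Require Import Defs.
From HB Require Import structures.
From mathcomp Require Import all_boot all_order all_algebra all_field.
From mathcomp Require Import complex.
From mathcomp Require Import reals.

Set Implicit Arguments.
Unset Strict Implicit.
Unset Printing Implicit Defensive.

Import Order.TTheory GRing.Theory Num.Theory.
Local Open Scope ring_scope.

(** A move only ever subtracts from a coordinate a natural multiple of a quantity
that admissibility makes positive.  For [V A B g] these quantities are [x_3] and
the new second coordinate [x_2 - B x_3]; for [W] they are [x_2] and the new first
coordinate [x_1 - x_2], which is what the third coordinate loses
([rcoord_apply_move_le]).  Since the maximum of the coordinates does not depend
on their order ([max_rcoord_le]), sorting leaves it unchanged, so it cannot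
increase in one step ([max_rcoord_step]), and induction gives the claim on
orbits. *)

Section Monotonicity.

Variables (R : realType) (K : fieldExtType rat) (sigma : {rmorphism K -> R}).

Implicit Types t : 3.-tuple K.

Lemma rcoord_apply_move_le t (m : move) :
    (forall i, 0 < rcoord sigma t i) -> admissible sigma m t ->
  forall i, rcoord sigma (apply_move m t) i <= rcoord sigma t i.
Proof.
move=> t_gt0 adm.
have inordE (i : 'I_3) k : i = k :> nat -> i = inord k.
  by move=> <-; rewrite inord_val.
case: m adm => [A B g|] adm i.
- have := adm (inord 1); rewrite /rcoord (tnth_nth 0) /= inordK //= => v_gt0.
  have := t_gt0 (inord 2); rewrite /rcoord => x3_gt0.
  case: i => [[|[|[|//]]] lti]; rewrite (tnth_nth 0) /=.
  + rewrite (inordE (Ordinal lti) 0%N) // 2!rmorphB 2!rmorphMn.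
    rewrite -addrA gerDl -opprD oppr_le0.
    by rewrite addr_ge0 // mulrn_wge0 // ltW.
  + rewrite (inordE (Ordinal lti) 1%N) // rmorphB rmorphMn gerDl oppr_le0.
    by rewrite mulrn_wge0 // ltW.
  + by rewrite (inordE (Ordinal lti) 2%N).
- have := adm (inord 0); rewrite /rcoord (tnth_nth 0) /= inordK //= => d_gt0.
  have := t_gt0 (inord 1); rewrite /rcoord => x2_gt0.
  case: i => [[|[|[|//]]] lti]; rewrite (tnth_nth 0) /=.
  + by rewrite (inordE (Ordinal lti) 0%N) // rmorphB gerDl oppr_le0 ltW.
  + by rewrite (inordE (Ordinal lti) 1%N).
  + rewrite (inordE (Ordinal lti) 2%N) // [leLHS]rmorphB gerDl oppr_le0.
    exact: ltW.
Qed.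

(** Quantifying over membership rather than over positions makes the maximum
visibly invariant under sorting. *)
Lemma max_rcoord_le t (M : R) :
  reflect {in t, forall x, sigma x <= M} (max_rcoord sigma t <= M).
Proof.
rewrite /max_rcoord !ge_max; apply: (iffP and3P) => [[le0 le1 le2] x|le_tM].
  case/tnthP=> i ->; rewrite -(inord_val i).
  by case: i => [[|[|[|//]]] lti].
by split; apply: le_tM; apply: mem_tnth.
Qed.

Lemma rcoord_le_max t i : rcoord sigma t i <= max_rcoord sigma t.
Proof.
have /max_rcoord_le le_t := lexx (max_rcoord sigma t).
by apply: le_t; apply: mem_tnth.
Qed.

Lemma max_rcoord_step t (m : move) :
    (forall i, 0 < rcoord sigma t i) -> admissible sigma m t ->
  max_rcoord sigma (resort sigma (apply_move m t)) <= max_rcoord sigma t.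
Proof.
move=> t_gt0 adm; apply/max_rcoord_le => x.
rewrite mem_sort => /tnthP[i ->].
exact: le_trans (rcoord_apply_move_le t_gt0 adm i) (rcoord_le_max t i).
Qed.

End Monotonicity.

Theorem proposition3p6 (R : realType) (K : fieldExtType rat)
    (dimK : \dim {:K}%VS = 3%N) (sigK : has_signature R K 1 1)
    (sigma_r : {rmorphism K -> R}) (L : {pred K}) (ordL : is_order L) :
  (forall (u : 3.-tuple K) (m : move),
     is_state sigma_r L u -> admissible sigma_r m u ->
     forall i : 'I_3,
       rcoord sigma_r (apply_move m u) i <= rcoord sigma_r u i) /\
  (forall (N : option nat) (s : nat -> 3.-tuple K) (m : nat -> move),
     is_orbit sigma_r L N s m ->
     forall k n : nat, (k <= n)%N -> in_orbit_range N n ->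
       max_rcoord sigma_r (s n) <= max_rcoord sigma_r (s k)).
Proof.
split=> [u m [_ _ u_gt0 _] adm i|N s m [st step] k n].
  exact: rcoord_apply_move_le.
elim: n => [|n IHn]; first by rewrite leqn0 => /eqP->.
rewrite leq_eqVlt => /predU1P[-> //|le_kn] inN1.
have inN : in_orbit_range N n by case: N inN1 {st step IHn} => //= ? /ltnW.
have [_ _ s_gt0 _] := st n inN.
have [adm ->] := step n inN1.
exact: le_trans (max_rcoord_step s_gt0 adm) (IHn le_kn inN).
Qed.
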